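(* Let $\bar x\in\mathbb{R}^n$ be an AW-stationary point of (MPCC), and let MPCC-subMFC be satisfied at $\bar x$ with $\{(x^k,\lambda^k,\delta^k,\varepsilon^k)\}_{k=1}^\infty\subset\mathbb{R}^n\times\mathbb{R}^\ell\times\mathbb{R}^\ell\times\mathbb{R}^n$, where $\lambda^k=(\lambda_g^k,\lambda_h^k,\lambda_G^k,\lambda_H^k)$ and $\delta^k=(\delta_g^k,\delta_h^k,\delta_G^k,\delta_H^k)$, being the involved approximately W-stationary sequence w.r.t. $\bar x$. Then the following assertions hold. (a) The point $\bar x$ is W-stationary. (b) Whenever $\{(x^k,\lambda^k,\delta^k,\varepsilon^k)\}_{k=1}^\infty$ is an approximately C-stationary sequence w.r.t. $\bar x$, then $\bar x$ is C-stationary. (c) Whenever $\{(x^k,\lambda^k,\delta^k,\varepsilon^k)\}_{k=1}^\infty$ is an approximately M-stationary sequence w.r.t. $\bar x$, then $\bar x$ is M-stationary. (d) Whenever $\{(x^k,\lambda^k,\delta^k,\varepsilon^k)\}_{k=1}^\infty$ is a strictly approximately S-stationary sequence w.r.t. $\bar x$, then $\bar x$ is S-stationary.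
   Context: (MPCC): $\min_x f(x)$ s.t. $g(x)\le0$, $h(x)=0$, $0\le G(x)\perp H(x)\ge0$, with continuously differentiable $f\colon\mathbb{R}^n\to\mathbb{R}$, $g\colon\mathbb{R}^n\to\mathbb{R}^m$, $h\colon\mathbb{R}^n\to\mathbb{R}^p$, $G,H\colon\mathbb{R}^n\to\mathbb{R}^q$, $q\ge1$. Set $\ell=m+p+2q$, $[r]=\{1,\dots,r\}$, $I^h=[p]$, $\operatorname{sgn}\colon\mathbb{R}\to\{-1,0,1\}$ the sign function, and, for $\lambda=(\lambda_g,\lambda_h,\lambda_G,\lambda_H)\in\mathbb{R}^\ell$, $$\mathcal L^{\mathrm{cc}}(x,\lambda)=f(x)+\lambda_g^\top g(x)+\lambda_h^\top h(x)-\lambda_G^\top G(x)-\lambda_H^\top H(x).$$ Index sets, for $x\in\mathbb{R}^n$, $\delta=(\delta_g,\delta_h,\delta_G,\delta_H)\in\mathbb{R}^\ell$: $I^g(x,\delta)=\{i\in[m]\mid g_i(x)=(\delta_g)_i\}$; $I_{0+}(x,\delta)=\{i\in[q]\mid G_i(x)=-(\delta_G)_i,\ H_i(x)>-(\delta_H)_i\}$; $I_{+0}(x,\delta)=\{i\in[q]\mid G_i(x)>-(\delta_G)_i,\ H_i(x)=-(\delta_H)_i\}$; $I_{00}(x,\delta)=\{i\in[q]\mid G_i(x)=-(\delta_G)_i,\ H_i(x)=-(\delta_H)_i\}$; $I^G(x,\delta)=I_{0+}(x,\delta)\cup I_{00}(x,\delta)$; $I^H(x,\delta)=I_{+0}(x,\delta)\cup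 I_{00}(x,\delta)$. For feasible $\bar x$, write $I^g(\bar x)=I^g(\bar x,0)$, and similarly $I_{0+}(\bar x),I_{+0}(\bar x),I_{00}(\bar x),I^G(\bar x),I^H(\bar x)$. Stationarity: a feasible $\bar x$ is W-stationary if there is $\lambda\in\mathbb{R}^\ell$ with $0=\nabla_x\mathcal L^{\mathrm{cc}}(\bar x,\lambda)$; $(\lambda_g)_i\ge0$, $(\lambda_g)_ig_i(\bar x)=0$ for all $i\in[m]$; $(\lambda_G)_i=0$ for all $i\in I_{+0}(\bar x)$; $(\lambda_H)_i=0$ for all $i\in I_{0+}(\bar x)$. It is C-, M-, S-stationary if it is W-stationary with some $\lambda$ additionally satisfying, for all $i\in I_{00}(\bar x)$: $(\lambda_G)_i(\lambda_H)_i\ge0$ (C); $\min\{(\lambda_G)_i,(\lambda_H)_i\}>0$ or $(\lambda_G)_i(\lambda_H)_i=0$ (M); $\min\{(\lambda_G)_i,(\lambda_H)_i\}\ge0$ (S). Approximate stationarity: a sequence $\{(x^k,\lambda^k,\delta^k,\varepsilon^k)\}_{k=1}^\infty$ is approximately W-stationary w.r.t. feasible $\bar x$ if $(x^k,\delta^k,\varepsilon^k)\to(\bar x,0,0)$ and, for all $k\in\mathbb{N}$: $\varepsilon^k=\nabla_x\mathcal L^{\mathrm{cc}}(x^k,\lambda^k)$; $(\lambda_g^k)_i\ge0$, $g_i(x^k)\le(\delta_g^k)_i$, $(\lambda_g^k)_i(g_i(x^k)-(\delta_g^k)_i)=0$ for $i\in[m]$; $h(x^k)=\delta_h^k$; and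 for $i\in[q]$: $G_i(x^k)\ge-(\delta_G^k)_i$, $(\lambda_G^k)_i(G_i(x^k)+(\delta_G^k)_i)=0$, $H_i(x^k)\ge-(\delta_H^k)_i$, $(\lambda_H^k)_i(H_i(x^k)+(\delta_H^k)_i)=0$, $(G_i(x^k)+(\delta_G^k)_i)(H_i(x^k)+(\delta_H^k)_i)=0$. The point $\bar x$ is AW-stationary if such a sequence exists. An approximately W-stationary sequence w.r.t. $\bar x$ is called approximately C-stationary, approximately M-stationary, or strictly approximately S-stationary w.r.t. $\bar x$ if, for all $k$ and all $i\in I_{00}(\bar x)$, respectively: $(\lambda_G^k)_i(\lambda_H^k)_i\ge0$; $\min\{(\lambda_G^k)_i,(\lambda_H^k)_i\}>0$ or $(\lambda_G^k)_i(\lambda_H^k)_i=0$; $\min\{(\lambda_G^k)_i,(\lambda_H^k)_i\}\ge0$. Convention: passing to subsequences, all approximately W-stationary sequences considered are taken such that $I^g(x^k,\delta^k)$, $I^G(x^k,\delta^k)$, $I^H(x^k,\delta^k)$ and the sign of each component of $\lambda^k$ do not depend on $k$. MPCC-subMFC holds at an AW-stationary point $\bar x$ if there exist $I_1\subset I^g(\bar x)$, $I_2\subset I^G(\bar x)$, $I_3\subset I^H(\bar x)$ and a sequence $\{(x^k,\lambda^k,\delta^k,\varepsilon^k)\}_{k=1}^\infty$ (the ''involved'' sequence) such that: (i) either $I_1=I^h=I_2=I_3=\emptyset$, or for all $(u,v,r,s)\in\mathbb{R}^{m+p+2q}\setminus\{(0,0,0,0)\}$ with $u\ge0$, $v\ge0$,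 $r\ge0$, $s\ge0$ and $u_{[m]\setminus I_1}=0$, $r_{[q]\setminus I_2}=0$, $s_{[q]\setminus I_3}=0$, $$0\neq\sum_{i\in I_1}u_i\nabla g_i(\bar x)+\sum_{i\in I^h}\operatorname{sgn}((\lambda_h^k)_i)v_i\nabla h_i(\bar x)-\sum_{i\in I_2}\operatorname{sgn}((\lambda_G^k)_i)r_i\nabla G_i(\bar x)-\sum_{i\in I_3}\operatorname{sgn}((\lambda_H^k)_i)s_i\nabla H_i(\bar x);$$ (ii) the sequence is approximately W-stationary w.r.t. $\bar x$, and $I_1=I^g(x^k,\delta^k)$, $I_2=I^G(x^k,\delta^k)$, $I_3=I^H(x^k,\delta^k)$ for all $k\in\mathbb{N}$. *)

(* Defs.v *)
(* MathComp-Analysis: the reals are any R : realType, and R^n is 'rV[R]_n. *)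
From HB Require Import structures.
From mathcomp Require Import all_boot all_order all_algebra.
From mathcomp Require Import classical_sets boolp functions reals.
From mathcomp Require Import topology normedtype sequences derive.

Set Implicit Arguments.
Unset Strict Implicit.
Unset Printing Implicit Defensive.

Import Order.TTheory GRing.Theory Num.Theory.
Import numFieldNormedType.Exports.
Local Open Scope ring_scope.

Section Calculus.
Context {R : realType} {n : nat}.

Definition gradient (f : 'rV[R]_n -> R) (x : 'rV[R]_n) : 'rV[R]_n :=
  \row_(j < n) derive f x (delta_mx 0 j).

Definition cont_diff (f : 'rV[R]_n -> R) : Prop :=
  (forall x, differentiable f x) /\ continuous (gradient f).

Definition cont_diff_vec d (F : 'rV[R]_n -> 'rV[R]_d) : Prop :=
  (forall x, differentiable F x) /\ continuous (jacobian F).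

Definition dot (u v : 'rV[R]_n) : R := \sum_(i < n) u 0 i * v 0 i.

End Calculus.

Record mpcc (R : realType) (n m p q : nat) := MPCC {
  obj : 'rV[R]_n -> R;
  cg : 'rV[R]_n -> 'rV[R]_m;
  ch : 'rV[R]_n -> 'rV[R]_p;
  cG : 'rV[R]_n -> 'rV[R]_q;
  cH : 'rV[R]_n -> 'rV[R]_q }.

(* R^l with l = m + p + 2q, split into its (g, h, G, H) blocks. *)
Definition blocks (R : realType) (m p q : nat) : Type :=
  ('rV[R]_m * 'rV[R]_p * 'rV[R]_q * 'rV[R]_q)%type.

Section Blocks.
Context {R : realType} {m p q : nat}.
Definition bg (a : blocks R m p q) : 'rV[R]_m := a.1.1.1.
Definition bh (a : blocks R m p q) : 'rV[R]_p := a.1.1.2.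
Definition bG (a : blocks R m p q) : 'rV[R]_q := a.1.2.
Definition bH (a : blocks R m p q) : 'rV[R]_q := a.2.
Definition blocks0 : blocks R m p q := (0, 0, 0, 0).
End Blocks.

Record iterates (R : realType) (n m p q : nat) := Iterates {
  it_x : nat -> 'rV[R]_n;
  it_lam : nat -> blocks R m p q;
  it_del : nat -> blocks R m p q;
  it_eps : nat -> 'rV[R]_n }.

Section MPCC_theory.
Context {R : realType} {n m p q : nat}.
Variable P : mpcc R n m p q.
Implicit Types (x xbar : 'rV[R]_n) (lam del : blocks R m p q).
Implicit Types (s : iterates R n m p q).

Definition smooth_mpcc : Prop :=
  [/\ cont_diff (obj P), cont_diff_vec (cg P), cont_diff_vec (ch P),
      cont_diff_vec (cG P) & cont_diff_vec (cH P)].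

Definition feasible x : Prop :=
  [/\ forall i, cg P x 0 i <= 0,
      ch P x = 0,
      forall i, 0 <= cG P x 0 i,
      forall i, 0 <= cH P x 0 i &
      dot (cG P x) (cH P x) = 0].

Definition Lcc x lam : R :=
  obj P x + dot (bg lam) (cg P x) + dot (bh lam) (ch P x)
  - dot (bG lam) (cG P x) - dot (bH lam) (cH P x).

Definition gradLcc x lam : 'rV[R]_n := gradient (fun y => Lcc y lam) x.

Definition Ig x del : {set 'I_m} :=
  [set i | cg P x 0 i == bg del 0 i]%SET.
Definition Ih : {set 'I_p} := finset.setT.
Definition I0p x del : {set 'I_q} :=
  [set i | (cG P x 0 i == - bG del 0 i) && (cH P x 0 i > - bH del 0 i)]%SET.
Definition Ip0 x del : {set 'I_q} :=
  [set i | (cG P x 0 i > - bG del 0 i) && (cH P x 0 i == - bH del 0 i)]%SET.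
Definition I00 x del : {set 'I_q} :=
  [set i | (cG P x 0 i == - bG del 0 i) && (cH P x 0 i == - bH del 0 i)]%SET.
Definition IG x del : {set 'I_q} := (I0p x del :|: I00 x del)%SET.
Definition IH x del : {set 'I_q} := (Ip0 x del :|: I00 x del)%SET.

(* Sign conditions on a pair of multipliers ((lam_G)_i, (lam_H)_i). *)
Definition C_pair (a b : R) : Prop := 0 <= a * b.
Definition M_pair (a b : R) : Prop := 0 < Num.min a b \/ a * b = 0.
Definition S_pair (a b : R) : Prop := 0 <= Num.min a b.

Definition biactive (Q : R -> R -> Prop) xbar lam : Prop :=
  forall i, i \in I00 xbar blocks0 -> Q (bG lam 0 i) (bH lam 0 i).

Definition W_multiplier x lam : Prop :=
  [/\ 0 = gradLcc x lam,
      forall i, 0 <= bg lam 0 i /\ bg lam 0 i * cg P x 0 i = 0,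
      forall i, i \in Ip0 x blocks0 -> bG lam 0 i = 0 &
      forall i, i \in I0p x blocks0 -> bH lam 0 i = 0].

Definition W_stationary x : Prop :=
  feasible x /\ exists lam, W_multiplier x lam.
Definition C_stationary x : Prop :=
  feasible x /\ exists lam, W_multiplier x lam /\ biactive C_pair x lam.
Definition M_stationary x : Prop :=
  feasible x /\ exists lam, W_multiplier x lam /\ biactive M_pair x lam.
Definition S_stationary x : Prop :=
  feasible x /\ exists lam, W_multiplier x lam /\ biactive S_pair x lam.

Definition approx_W_at x lam del (eps : 'rV[R]_n) : Prop :=
  [/\ eps = gradLcc x lam,
      forall i, [/\ 0 <= bg lam 0 i, cg P x 0 i <= bg del 0 i &
                    bg lam 0 i * (cg P x 0 i - bg del 0 i) = 0],
      ch P x = bh del &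
      forall i, [/\ - bG del 0 i <= cG P x 0 i,
                    bG lam 0 i * (cG P x 0 i + bG del 0 i) = 0,
                    - bH del 0 i <= cH P x 0 i,
                    bH lam 0 i * (cH P x 0 i + bH del 0 i) = 0 &
                    (cG P x 0 i + bG del 0 i) * (cH P x 0 i + bH del 0 i) = 0]].

Definition approx_W xbar s : Prop :=
  [/\ feasible xbar,
      ((fun k => (it_x s k, it_del s k, it_eps s k)) @ \oo
         --> (xbar, blocks0, (0 : 'rV[R]_n)))%classic &
      forall k, approx_W_at (it_x s k) (it_lam s k) (it_del s k) (it_eps s k)].

Definition AW_stationary xbar : Prop := exists s, approx_W xbar s.

Definition approx_C xbar s : Prop :=
  approx_W xbar s /\ forall k, biactive C_pair xbar (it_lam s k).
Definition approx_M xbar s : Prop :=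
  approx_W xbar s /\ forall k, biactive M_pair xbar (it_lam s k).
Definition strict_approx_S xbar s : Prop :=
  approx_W xbar s /\ forall k, biactive S_pair xbar (it_lam s k).

Definition same_signs d (u v : 'rV[R]_d) : Prop :=
  forall i, Num.sg (u 0 i) = Num.sg (v 0 i).

(* What passing to a subsequence achieves for any approximately W-stationary
   sequence: active sets and multiplier signs do not depend on k. *)
Definition constant_pattern s : Prop := forall k l,
  [/\ Ig (it_x s k) (it_del s k) = Ig (it_x s l) (it_del s l),
      IG (it_x s k) (it_del s k) = IG (it_x s l) (it_del s l) &
      IH (it_x s k) (it_del s k) = IH (it_x s l) (it_del s l)] /\
  [/\ same_signs (bg (it_lam s k)) (bg (it_lam s l)),
      same_signs (bh (it_lam s k)) (bh (it_lam s l)),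
      same_signs (bG (it_lam s k)) (bG (it_lam s l)) &
      same_signs (bH (it_lam s k)) (bH (it_lam s l))].

Definition signed_combination xbar lam (I1 : {set 'I_m}) (I2 I3 : {set 'I_q})
    (w : blocks R m p q) : 'rV[R]_n :=
  \sum_(i in I1) bg w 0 i *: gradient (fun y => cg P y 0 i) xbar
  + \sum_(i in Ih)
      (Num.sg (bh lam 0 i) * bh w 0 i) *: gradient (fun y => ch P y 0 i) xbar
  - \sum_(i in I2)
      (Num.sg (bG lam 0 i) * bG w 0 i) *: gradient (fun y => cG P y 0 i) xbar
  - \sum_(i in I3)
      (Num.sg (bH lam 0 i) * bH w 0 i) *: gradient (fun y => cH P y 0 i) xbar.

Definition nonneg_blocks (w : blocks R m p q) : Prop :=
  [/\ forall i, 0 <= bg w 0 i, forall i, 0 <= bh w 0 i,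
      forall i, 0 <= bG w 0 i & forall i, 0 <= bH w 0 i].

Definition supported_blocks (I1 : {set 'I_m}) (I2 I3 : {set 'I_q})
    (w : blocks R m p q) : Prop :=
  [/\ forall i, i \notin I1 -> bg w 0 i = 0,
      forall i, i \notin I2 -> bG w 0 i = 0 &
      forall i, i \notin I3 -> bH w 0 i = 0].

Definition positively_independent xbar s (I1 : {set 'I_m}) (I2 I3 : {set 'I_q})
    : Prop :=
  [/\ I1 = finset.set0, Ih = finset.set0, I2 = finset.set0
    & I3 = finset.set0] \/
  forall k (w : blocks R m p q), w <> blocks0 ->
    nonneg_blocks w -> supported_blocks I1 I2 I3 w ->
    signed_combination xbar (it_lam s k) I1 I2 I3 w <> 0.

(* MPCC-subMFC at xbar, with s the involved sequence. *)
Definition subMFC_with xbar s : Prop :=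
  exists (I1 : {set 'I_m}) (I2 I3 : {set 'I_q}),
    [/\ I1 \subset Ig xbar blocks0, I2 \subset IG xbar blocks0 &
        I3 \subset IH xbar blocks0] /\
    [/\ positively_independent xbar s I1 I2 I3,
        approx_W xbar s,
        constant_pattern s &
        forall k, [/\ I1 = Ig (it_x s k) (it_del s k),
                      I2 = IG (it_x s k) (it_del s k) &
                      I3 = IH (it_x s k) (it_del s k)]].

End MPCC_theory.

(* Main.v *)
Require Import Defs.
From mathcomp Require Import all_boot all_order all_algebra reals.
From mathcomp Require Import classical_sets boolp functions.
From mathcomp Require Import prodnormedzmodule topology normedtype derive.

Set Implicit Arguments.
Unset Strict Implicit.
Unset Printing Implicit Defensive.

Import Order.TTheory GRing.Theory Num.Theory.
Import numFieldNormedType.Exports.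
Local Open Scope classical_set_scope.
Local Open Scope ring_scope.

(** The multipliers of the involved sequence may be unbounded, so they cannot be
    passed to the limit directly.  Scale the pair (1, lambda^k) to norm one: all
    conditions on lambda^k other than the value 1 of the weight of the objective
    are homogeneous, and the unit sphere is compact, so a limit (t, mu) exists
    along some filter finer than k -> oo.  Continuity of the gradients turns
    eps^k = gradL(x^k, lambda^k) into the Fritz John identity
      t grad f(xbar) + (combination of constraint gradients with weights mu) = 0.

    The weight t cannot vanish.  The active sets I_1, I_2, I_3 support every
    lambda^k by complementarity, and the signs of lambda^k do not depend on k;
    both properties survive in mu, so that mu = sgn(lambda^0) |mu|.  If t = 0,
    then mu is nonzero and |mu| is a nonnegative, correctly supported weight for
    which the signed combination of gradients vanishes, which is exactly what
    MPCC-subMFC forbids (supported_independent).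

    Hence lambda = mu / t is a multiplier at xbar.  Its vanishing components are
    the right ones because the active sets along the sequence are contained in
    those of xbar.  The C-, M- and S-conditions on a pair of multipliers each
    describe a closed cone in the plane, so a condition holding along the
    sequence holds for lambda as well; one and the same lambda therefore serves
    all four assertions (W_multiplier_limit). *)

(** * Gradients through Jacobians *)

Section Gradients.
Context {R : realType} {n d : nat}.
Implicit Types (F : 'rV[R]_n -> 'rV[R]_d) (x : 'rV[R]_n) (v : 'rV[R]_d).

Lemma derivable_coord F x u i :
  differentiable F x -> derivable (fun y => F y 0 i) x u.
Proof. by move=> dF; apply/(derivable_mxP F x u).1/diff_derivable. Qed.

Lemma derive_coord F x u i :
  differentiable F x -> derive (fun y => F y 0 i) x u = (u *m jacobian F x) 0 i.
Proof.
move=> dF; rewrite -deriveEjacobian// derive_mx ?mxE//.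
exact: diff_derivable.
Qed.

Lemma gradient_coordE F x i :
  differentiable F x -> gradient (fun y => F y 0 i) x = row i (jacobian F x)^T.
Proof.
by move=> dF; apply/rowP => j; rewrite !mxE derive_coord// -rowE !mxE.
Qed.

Lemma is_derive_dot F x u v :
  differentiable F x ->
  is_derive x u (fun y => dot v (F y))
    (\sum_(i < d) v 0 i * derive (fun y => F y 0 i) x u).
Proof.
move=> dF.
have -> : (fun y => dot v (F y)) = \sum_(i < d) (v 0 i *: (fun y => F y 0 i)).
  by apply/funext => y; rewrite fct_sumE.
apply: is_derive_sum => i; apply: is_deriveZ.
exact/derivableP/derivable_coord.
Qed.

Lemma gradient_sumE F x v :
  differentiable F x ->
  \sum_(i < d) v 0 i *: gradient (fun y => F y 0 i) x = v *m (jacobian F x)^T.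
Proof.
move=> dF; rewrite mulmx_sum_row; apply: eq_bigr => i _.
by rewrite gradient_coordE.
Qed.

Lemma gradient_dotE F x v :
  differentiable F x ->
  gradient (fun y => dot v (F y)) x = v *m (jacobian F x)^T.
Proof.
move=> dF; rewrite -gradient_sumE//; apply/rowP => j; rewrite mxE.
have dotF := is_derive_dot (delta_mx 0 j) v dF.
by rewrite derive_val summxE; apply: eq_bigr => i _; rewrite !mxE.
Qed.

Lemma cvg_entry (T : Type) (U : set_system T) {FU : Filter U} a b
    (M_ : T -> 'M[R]_(a, b)) (M : 'M[R]_(a, b)) i j :
  M_ @ U --> M -> M_ k i j @[k --> U] --> M i j.
Proof.
by move=> cM; apply: (continuous_cvg _ (@coord_continuous _ _ _ i j M) cM).
Qed.

Lemma cvg_mulmx_trmx_coord (T : Type) (U : set_system T) {FU : ProperFilter U}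
    (v_ : T -> 'rV[R]_d) v (J_ : T -> 'M[R]_(n, d)) (J : 'M[R]_(n, d)) j :
  v_ @ U --> v -> J_ @ U --> J ->
  (v_ k *m (J_ k)^T) 0 j @[k --> U] --> (v *m J^T) 0 j.
Proof.
move=> cv cJ.
rewrite mxE (_ : (fun k => _) = (fun k => \sum_i v_ k 0 i * J_ k j i)); last first.
  by apply/funext => k; rewrite mxE; apply: eq_bigr => i _; rewrite mxE.
apply: cvg_big => [|i _]; first exact: add_continuous.
by rewrite mxE; apply: cvgM; exact: cvg_entry.
Qed.

End Gradients.

Arguments cvg_entry {R T U FU a b M_ M} i j _.

(** * Compactness of the unit ball and limits of normalised sequences *)

Lemma cvg_proj1 (V W : topologicalType) (T : Type) (U : set_system T)
    {FU : Filter U} (z_ : T -> V * W) (z : V * W) :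
  z_ @ U --> z -> (z_ k).1 @[k --> U] --> z.1.
Proof. by move=> cz; apply: (cvg_comp _ _ cz); exact: cvg_fst. Qed.

Lemma cvg_proj2 (V W : topologicalType) (T : Type) (U : set_system T)
    {FU : Filter U} (z_ : T -> V * W) (z : V * W) :
  z_ @ U --> z -> (z_ k).2 @[k --> U] --> z.2.
Proof. by move=> cz; apply: (cvg_comp _ _ cz); exact: cvg_snd. Qed.

Section Compactness.
Context {R : realType}.

Definition unit_ball (V : normedModType R) : set V := [set v | `|v| <= 1].
Arguments unit_ball : clear implicits.

Lemma compact_unit_ball_scalar : compact (unit_ball R^o).
Proof.
rewrite (_ : unit_ball _ = `[(-1 : R), 1]%classic); first exact: segment_compact.
by apply/seteqP; split=> x; rewrite /unit_ball/= in_itv/= ler_norml.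
Qed.

Lemma compact_unit_ball_row d : compact (unit_ball 'rV[R]_d).
Proof.
apply: bounded_closed_compact.
  by exists 1; split=> // y y1 v /= v1; exact: le_trans v1 (ltW y1).
apply: (@preimage_closed _ _ (fun v : 'rV[R]_d => `|v|) [set y | y <= 1]) => //.
  by move=> v _; exact: norm_continuous.
Qed.

Lemma compact_unit_ball_prod (V W : normedModType R) :
  compact (unit_ball V) -> compact (unit_ball W) ->
  compact (unit_ball (V * W)%type).
Proof.
move=> cV cW; rewrite (_ : unit_ball _ = unit_ball V `*` unit_ball W).
  exact: compact_setX.
apply/seteqP; split=> -[v w]; rewrite /unit_ball/= prod_normE/= ge_max.
  by case/andP.
by case=> -> ->.
Qed.

(** This is extraction of a convergent subsequence, with a filter on the indices
    in place of a subsequence: an ultrafilter U finer than the one at infinity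
    works, since along U the sequence converges to each of its cluster points. *)
Lemma compact_subfilter (V : topologicalType) (K : set V) (z_ : nat -> V) :
  compact K -> (forall k, K (z_ k)) ->
  exists (U : set_system nat) (z : V),
    [/\ ProperFilter U, \oo `<=` U, K z & z_ @ U --> z].
Proof.
move=> cK Kz.
have [U [UU sU]] := @ultraFilterLemma nat \oo _.
have PU : ProperFilter U := @ultra_proper _ _ UU.
have [z [Kzz cz]] : K `&` cluster (z_ @ U) !=set0.
  by apply: cK; apply: (@filterE _ U).
exists U, z; split=> // B Bz.
have [//|UnB] := in_ultra_setVsetC (z_ @^-1` B) UU.
by have [y [/= nBy By]] := cz (~` B) B UnB Bz.
Qed.

Lemma cvg_normalized_subfilter (V : normedModType R) (z_ : nat -> V) :
  compact (unit_ball V) -> (forall k, z_ k != 0) ->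
  exists (U : set_system nat) (z : V),
    [/\ ProperFilter U, \oo `<=` U, `|z| = 1 &
        `|z_ k|^-1 *: z_ k @[k --> U] --> z].
Proof.
move=> cB z0; set y_ := fun k => `|z_ k|^-1 *: z_ k.
have y1 k : `|y_ k| = 1.
  by rewrite normrZ normfV normr_id mulVf// normr_eq0.
have [||U [z [FU sU _ cz]]] := @compact_subfilter V (unit_ball V) y_ => //.
  by move=> k; rewrite /unit_ball/= y1.
exists U, z; split=> //.
apply: (@closed_cvg _ _ U _ (fun k => `|y_ k|) [set r | r = 1]) => //.
- by apply: nearW => k /=; rewrite y1.
- exact: cvg_norm.
Qed.

End Compactness.

Arguments unit_ball {R} V _.

(** * Sign conditions that are closed cones *)

Section ClosedCones.
Context {R : realType}.
Implicit Types Q : R -> R -> Prop.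

(** Closedness lets a sign condition pass to the limit of the normalised
    multipliers; stability under positive factors lets it survive both the
    normalisation and the final division by t. *)
Definition closed_cone Q : Prop :=
  (forall c a b, 0 < c -> Q a b -> Q (c * a) (c * b)) /\
  closed [set z : R * R | Q z.1 z.2].

Lemma closed_cone_cvg Q (T : Type) (U : set_system T) {FU : ProperFilter U}
    (a_ b_ : T -> R) a b :
  closed_cone Q -> (forall k, Q (a_ k) (b_ k)) ->
  a_ @ U --> a -> b_ @ U --> b -> Q a b.
Proof.
move=> [_ clQ] Qk ca cb.
have cab : (a_ k, b_ k) @[k --> U] --> (a, b)
  by exact: (@cvg_pair _ _ _ U (nbhs a) (nbhs b)).
apply: (@closed_cvg _ _ U _ (fun k => (a_ k, b_ k)) _ clQ _ (a, b) cab).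
exact: nearW.
Qed.

Lemma closed_cone_C : closed_cone (@C_pair R).
Proof.
split=> [c a b c0|]; rewrite /C_pair.
  by rewrite mulrACA => ab; rewrite mulr_ge0// mulr_ge0// ltW.
apply: (@preimage_closed _ _ (fun z : R * R => z.1 * z.2) [set y | 0 <= y]).
  by move=> z _; exact: mul_continuous.
exact: closed_ge.
Qed.

Lemma closed_nonneg_quadrant : closed [set z : R * R | 0 <= z.1 /\ 0 <= z.2].
Proof.
apply: closedI.
  apply: (@preimage_closed _ _ (@fst R R) [set y | 0 <= y]).
    by move=> z _; exact: cvg_fst.
  exact: closed_ge.
apply: (@preimage_closed _ _ (@snd R R) [set y | 0 <= y]).
  by move=> z _; exact: cvg_snd.
exact: closed_ge.
Qed.

Lemma S_pairE (a b : R) : S_pair a b <-> 0 <= a /\ 0 <= b.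
Proof. by rewrite /S_pair le_min; split=> [/andP//|[-> ->]]. Qed.

Lemma closed_cone_S : closed_cone (@S_pair R).
Proof.
split=> [c a b c0|].
  by rewrite !S_pairE => -[a0 b0]; rewrite !mulr_ge0// ltW.
rewrite (_ : mkset _ = [set z : R * R | 0 <= z.1 /\ 0 <= z.2]).
  exact: closed_nonneg_quadrant.
by apply/funext => z; apply/propext; exact: S_pairE.
Qed.

(** The strict inequality in M_pair hides that it defines a closed set: the
    boundary of the quadrant is made of pairs with zero product. *)
Lemma M_pairE (a b : R) : M_pair a b <-> (0 <= a /\ 0 <= b) \/ a * b = 0.
Proof.
rewrite /M_pair lt_min; split=> [[/andP[a0 b0]|->]|[[a0 b0]|->]]; try by right.
  by left; rewrite !ltW.
have [->|an0] := eqVneq a 0; first by right; rewrite mul0r.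
have [->|bn0] := eqVneq b 0; first by right; rewrite mulr0.
by left; rewrite !lt_def an0 bn0 a0.
Qed.

Lemma closed_cone_M : closed_cone (@M_pair R).
Proof.
split=> [c a b c0|].
  rewrite !M_pairE => -[[a0 b0]|ab0].
    by left; rewrite !mulr_ge0// ltW.
  by right; rewrite mulrACA ab0 mulr0.
rewrite (_ : mkset _ =
    [set z : R * R | 0 <= z.1 /\ 0 <= z.2] `|` [set z : R * R | z.1 * z.2 = 0]).
  apply: closedU; first exact: closed_nonneg_quadrant.
  apply: (@preimage_closed _ _ (fun z : R * R => z.1 * z.2) [set y | y = 0]).
    by move=> z _; exact: mul_continuous.
  exact: closed_eq.
by apply/funext => z; apply/propext; exact: M_pairE.
Qed.

End ClosedCones.

(** * The Fritz John combination of gradients *)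

Section FritzJohn.
Context {R : realType} {n m p q : nat}.
Context (P : mpcc R n m p q).
Implicit Types (x xbar : 'rV[R]_n) (lam mu : blocks R m p q).

(** Weighting the objective by t makes the gradient of the MPCC-Lagrangian
    homogeneous in (t, mu). *)
Definition fritz_john x (t : R) mu : 'rV[R]_n :=
  t *: gradient (obj P) x + bg mu *m (jacobian (cg P) x)^T
  + bh mu *m (jacobian (ch P) x)^T
  - bG mu *m (jacobian (cG P) x)^T - bH mu *m (jacobian (cH P) x)^T.

Lemma fritz_john_entry x t mu j :
  fritz_john x t mu 0 j =
  t * gradient (obj P) x 0 j + (bg mu *m (jacobian (cg P) x)^T) 0 j
  + (bh mu *m (jacobian (ch P) x)^T) 0 j - (bG mu *m (jacobian (cG P) x)^T) 0 j
  - (bH mu *m (jacobian (cH P) x)^T) 0 j.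
Proof.
rewrite /fritz_john.
move: (bg mu *m _) (bh mu *m _) (bG mu *m _) (bH mu *m _) => vg vh vG vH.
by move: (gradient _ x) => vf; rewrite !mxE.
Qed.

Lemma fritz_johnZ x c t mu :
  fritz_john x (c * t) (c *: mu) = c *: fritz_john x t mu.
Proof.
rewrite /fritz_john !scalerBr !scalerDr scalerA.
by rewrite -!scalemxAl.
Qed.

Lemma cvg_blocks (T : Type) (U : set_system T) {FU : Filter U}
    (mu_ : T -> blocks R m p q) mu :
  mu_ @ U --> mu ->
  [/\ bg (mu_ k) @[k --> U] --> bg mu, bh (mu_ k) @[k --> U] --> bh mu,
      bG (mu_ k) @[k --> U] --> bG mu & bH (mu_ k) @[k --> U] --> bH mu].
Proof.
move=> c; split; last exact: cvg_proj2 c.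
- exact: cvg_proj1 (cvg_proj1 (cvg_proj1 c)).
- exact: cvg_proj2 (cvg_proj1 (cvg_proj1 c)).
- exact: cvg_proj2 (cvg_proj1 c).
Qed.

Context (hP : smooth_mpcc P).

Lemma gradLccE x lam : gradLcc P x lam = fritz_john x 1 lam.
Proof.
case: hP => -[df _] [dg _] [dh _] [dG _] [dH _].
rewrite /fritz_john -!gradient_dotE// scale1r.
apply/rowP => j; rewrite !mxE.
set u := delta_mx 0 j.
have Hf : is_derive x u (obj P) (derive (obj P) x u).
  exact/derivableP/diff_derivable.
have Hg := is_derive_dot u (bg lam) (dg x).
have Hh := is_derive_dot u (bh lam) (dh x).
have HG := is_derive_dot u (bG lam) (dG x).
have HH := is_derive_dot u (bH lam) (dH x).
set Fg := (fun y => dot (bg lam) _) in Hg *.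
set Fh := (fun y => dot (bh lam) _) in Hh *.
set FG := (fun y => dot (bG lam) _) in HG *.
set FH := (fun y => dot (bH lam) _) in HH *.
rewrite (_ : (fun y => _) = obj P + Fg + Fh - FG - FH)//.
rewrite (@derive_val _ _ _ _ _ _ _ Hg) (@derive_val _ _ _ _ _ _ _ Hh).
by rewrite (@derive_val _ _ _ _ _ _ _ HG) (@derive_val _ _ _ _ _ _ _ HH) derive_val.
Qed.

Lemma fritz_john_cvg (T : Type) (U : set_system T) {FU : ProperFilter U}
    (x_ : T -> 'rV[R]_n) x (t_ : T -> R) (t : R) (mu_ : T -> blocks R m p q) mu j :
  x_ @ U --> x -> t_ @ U --> t -> mu_ @ U --> mu ->
  fritz_john (x_ k) (t_ k) (mu_ k) 0 j @[k --> U] --> fritz_john x t mu 0 j.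
Proof.
case: hP => -[_ cf] [_ cJg] [_ cJh] [_ cJG] [_ cJH] cx ct.
move=> /cvg_blocks[cbg cbh cbG cbH].
have congr (f g : T -> R) (a b : R) :
    (forall k, f k = g k) -> a = b -> g @ U --> b -> f @ U --> a.
  by move=> /funext -> ->.
apply: (congr _ _ _ _ (fun k => fritz_john_entry (x_ k) (t_ k) (mu_ k) j)
                      (fritz_john_entry x t mu j)).
have cJ d (J : 'rV[R]_n -> 'M[R]_(n, d)) (v_ : T -> 'rV[R]_d) (v : 'rV[R]_d) :
    continuous J -> v_ @ U --> v ->
    (v_ k *m (J (x_ k))^T) 0 j @[k --> U] --> (v *m (J x)^T) 0 j.
  move=> cJ cv; apply: cvg_mulmx_trmx_coord => //.
  exact: (continuous_cvg _ (cJ x) cx).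
apply: cvgB (cJ _ _ _ _ cJH cbH); apply: cvgB (cJ _ _ _ _ cJG cbG).
apply: cvgD (cJ _ _ _ _ cJh cbh); apply: cvgD (cJ _ _ _ _ cJg cbg).
apply: cvgM => //; apply: cvg_entry; exact: (continuous_cvg _ (cf x) cx).
Qed.

End FritzJohn.

Arguments fritz_john_cvg {R n m p q P} hP {T U FU x_ x t_ t mu_ mu} j _ _ _.

(** * Limits of normalised multipliers *)

Section Homogenisation.
Context {R : realType} {m p q : nat}.
Implicit Types lam mu : blocks R m p q.

Lemma compact_unit_ball_blocks :
  compact (unit_ball (R^o * blocks R m p q)%type).
Proof.
do ![exact: compact_unit_ball_scalar | exact: compact_unit_ball_row
    | apply: compact_unit_ball_prod].
Qed.

(** Here c_ k is the inverse norm of (1, lam_ k), so (t, mu) has norm one; this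
    is why t = 0 forces mu to be nonzero. *)
Lemma cvg_homogenised (lam_ : nat -> blocks R m p q) :
  exists (U : set_system nat) (c_ : nat -> R) (t : R) (mu : blocks R m p q),
    [/\ ProperFilter U, \oo `<=` U, forall k, 0 < c_ k, 0 <= t &
        (t = 0 -> mu <> blocks0)] /\
    (c_ @ U --> t /\ c_ k *: lam_ k @[k --> U] --> mu).
Proof.
pose z_ k : R^o * blocks R m p q := (1, lam_ k).
have z0 k : z_ k != 0 by apply/eqP => -[/eqP]; rewrite oner_eq0.
have [U [[t mu] [FU sU n1 cz]]] :=
  cvg_normalized_subfilter compact_unit_ball_blocks z0.
pose c_ k := `|z_ k|^-1.
have c0 k : 0 < c_ k by rewrite invr_gt0 normr_gt0.
have ct : c_ @ U --> t.
  have -> : c_ = (fun k => c_ k * 1) by apply/funext => k; rewrite mulr1.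
  exact: (cvg_proj1 cz).
exists U, c_, t, mu; split; last by split=> //; exact: (cvg_proj2 cz).
split=> //.
- apply: (@closed_cvg _ _ U _ _ _ (@closed_ge R 0) _ _ ct).
  by apply: nearW => k /=; exact: ltW.
- move=> t0 mu0; move: n1; rewrite t0 mu0 => /eqP.
  by rewrite -[(0, _)]/(0 : R^o * blocks R m p q) normr0 eq_sym oner_eq0.
Qed.

End Homogenisation.

(** * The limit multiplier *)

Section MultiplierLimit.
Context {R : realType} {n m p q : nat}.
Context (P : mpcc R n m p q).
Context (hP : smooth_mpcc P).
Implicit Types (x xbar : 'rV[R]_n) (lam mu del : blocks R m p q).

(** Complementarity: a multiplier is nonzero only where its own constraint is
    active.  For G and H the active set is a union of two index sets; since
    approximate feasibility bounds the other constraint function from below,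
    a single equation cuts out their union. *)
Lemma approx_W_supported x lam del eps :
  approx_W_at P x lam del eps ->
  supported_blocks (Ig P x del) (IG P x del) (IH P x del) lam.
Proof.
move=> [_ Hg _ HGH]; split=> i.
- have [_ _ /eqP] := Hg i.
  by rewrite mulf_eq0 subr_eq0 inE => /orP[/eqP->//|->].
- have [G0 /eqP cG0 H0 _ _] := HGH i.
  rewrite !inE; move: cG0; rewrite mulf_eq0 addr_eq0 => /orP[/eqP->//|->] /=.
  by rewrite eq_sym lt_neqAle H0 andbT; case: (_ == _).
- have [G0 _ H0 /eqP cH0 _] := HGH i.
  rewrite !inE; move: cH0; rewrite mulf_eq0 addr_eq0 => /orP[/eqP->//|->] /=.
  by rewrite !andbT [_ == - _]eq_sym lt_neqAle G0 andbT; case: (_ == _).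
Qed.

Definition abs_blocks mu : blocks R m p q :=
  (map_mx Num.norm (bg mu), map_mx Num.norm (bh mu),
   map_mx Num.norm (bG mu), map_mx Num.norm (bH mu)).

Lemma abs_blocks_nonneg mu : nonneg_blocks (abs_blocks mu).
Proof. by split=> i; rewrite mxE normr_ge0. Qed.

Lemma abs_blocks_eq0 mu : abs_blocks mu = blocks0 -> mu = blocks0.
Proof.
case: mu => [[[a b] c] d] [A B C D].
have abs0 e (v : 'rV[R]_e) : map_mx Num.norm v = 0 -> v = 0.
  move=> /rowP v0; apply/rowP => i; have := v0 i.
  by rewrite !mxE => /eqP; rewrite normr_eq0 => /eqP.
by rewrite (abs0 _ a A) (abs0 _ b B) (abs0 _ c C) (abs0 _ d D).
Qed.

Lemma abs_blocks_supported I1 I2 I3 mu :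
  supported_blocks I1 I2 I3 mu -> supported_blocks I1 I2 I3 (abs_blocks mu).
Proof.
by case=> s1 s2 s3; split=> i iI; rewrite mxE ?s1 ?s2 ?s3// normr0.
Qed.

(** Every sign of v is zero or the sign of the same entry of u.  Unlike equality
    of signs, which a limit destroys by sending entries to zero, this relation
    is closed in v. *)
Definition sign_dominated d (u v : 'rV[R]_d) : Prop :=
  forall i, Num.sg (u 0 i) * `|v 0 i| = v 0 i.

Lemma signed_sumE d (F : 'rV[R]_n -> 'rV[R]_d) x (u v : 'rV[R]_d)
    (I : {set 'I_d}) :
  differentiable F x -> sign_dominated u v ->
  (forall i, i \notin I -> v 0 i = 0) ->
  \sum_(i in I) (Num.sg (u 0 i) * `|v 0 i|) *: gradient (fun y => F y 0 i) x
  = v *m (jacobian F x)^T.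
Proof.
move=> dF uv v0; rewrite -gradient_sumE// big_mkcond; apply: eq_bigr => i _.
by case: ifPn => [_|/v0->]; rewrite ?uv// scale0r.
Qed.

Lemma signed_combinationE x lam mu I1 I2 I3 :
  (forall i, 0 <= bg mu 0 i) ->
  sign_dominated (bh lam) (bh mu) -> sign_dominated (bG lam) (bG mu) ->
  sign_dominated (bH lam) (bH mu) -> supported_blocks I1 I2 I3 mu ->
  signed_combination P x lam I1 I2 I3 (abs_blocks mu) = fritz_john P x 0 mu.
Proof.
move=> mug0 sh sG sH [s1 s2 s3].
case: hP => _ [dg _] [dh _] [dG _] [dH _].
rewrite /fritz_john scale0r add0r /signed_combination /abs_blocks.
have rw d (F : 'rV[R]_n -> 'rV[R]_d) (u v : 'rV[R]_d) (I : {set 'I_d}) :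
    \sum_(i in I) (Num.sg (u 0 i) * (map_mx Num.norm v) 0 i)
        *: gradient (fun y => F y 0 i) x =
    \sum_(i in I) (Num.sg (u 0 i) * `|v 0 i|) *: gradient (fun y => F y 0 i) x.
  by apply: eq_bigr => i _; rewrite mxE.
rewrite [bg _]/= [bh (_, _, _, _)]/= [bG (_, _, _, _)]/= [bH (_, _, _, _)]/=.
rewrite !rw !signed_sumE//; last by move=> i; rewrite inE.
congr (_ + _ - _ - _).
rewrite -gradient_sumE// big_mkcond; apply: eq_bigr => i _.
by rewrite mxE ger0_norm//; case: ifPn => // /s1->; rewrite scale0r.
Qed.

(** Positive independence only speaks of nonnegative weights; a sign-dominated mu
    is covered through the weight |mu|, since the signs of the multipliers are
    built into the signed combination. *)
Lemma supported_independent xbar s I1 I2 I3 k mu :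
  positively_independent P xbar s I1 I2 I3 ->
  supported_blocks I1 I2 I3 mu ->
  (forall i, 0 <= bg mu 0 i) ->
  sign_dominated (bh (it_lam s k)) (bh mu) ->
  sign_dominated (bG (it_lam s k)) (bG mu) ->
  sign_dominated (bH (it_lam s k)) (bH mu) ->
  fritz_john P xbar 0 mu = 0 -> mu = blocks0.
Proof.
(* In the degenerate case all components of mu lie outside the support. *)
case=> [[-> Ih0 -> ->] | ind] sup mug0 sh sG sH fj0.
  case: mu {fj0 mug0 sh sG sH} sup => [[[a b] c] d] [/= s1 s2 s3].
  have p0 (i : 'I_p) : i \in (finset.set0 : {set 'I_p}) by rewrite -Ih0 inE.
  rewrite /blocks0; congr (_, _, _, _); apply/rowP => i; rewrite mxE.
  - by apply: s1; rewrite inE.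
  - by have := p0 i; rewrite inE.
  - by apply: s2; rewrite inE.
  - by apply: s3; rewrite inE.
have [//|mu0] := EM (mu = blocks0).
exfalso; apply: (ind k (abs_blocks mu)).
- by move=> /abs_blocks_eq0.
- exact: abs_blocks_nonneg.
- exact: abs_blocks_supported.
- by rewrite signed_combinationE.
Qed.

Lemma closed_cvg_entry d (v_ : nat -> 'rV[R]_d) (v : 'rV[R]_d) (U : set_system nat)
    {FU : ProperFilter U} (A : set R) i :
  closed A -> v_ @ U --> v -> (forall k, A (v_ k 0 i)) -> A (v 0 i).
Proof.
move=> clA cv Ak.
apply: (@closed_cvg _ _ U _ (fun k => v_ k 0 i) A clA _ _ (cvg_entry 0 i cv)).
exact: nearW.
Qed.

Lemma closed_sign_dominated (a : R) :
  closed [set y : R | Num.sg a * `|y| = y].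
Proof.
rewrite (_ : mkset _ = (fun y : R => Num.sg a * `|y| - y) @^-1` [set y | y = 0]).
  apply: preimage_closed; last exact: closed_eq.
  move=> y _; apply: cvgB => //; apply: cvgM; first exact: cvg_cst.
  exact: norm_continuous.
by apply/funext => y; apply/propext; split=> /= [->|/eqP];
  rewrite ?subrr// subr_eq0 => /eqP.
Qed.

Lemma sign_dominated_cvg d (u : 'rV[R]_d) (v_ : nat -> 'rV[R]_d) (v : 'rV[R]_d)
    (c_ : nat -> R) (U : set_system nat) {FU : ProperFilter U} :
  (forall k, 0 < c_ k) -> (forall k, same_signs u (v_ k)) ->
  c_ k *: v_ k @[k --> U] --> v -> sign_dominated u v.
Proof.
move=> c0 uv cv i.
apply: (closed_cvg_entry (@closed_sign_dominated (u 0 i)) cv) => k /=.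
by rewrite mxE (uv k i) normrM gtr0_norm// mulrCA -numEsg.
Qed.

(** The multiplier does not depend on the cone Q, hence the W-stationarity of xbar
    and each of its refinements come from a single limit. *)
Lemma W_multiplier_limit xbar s :
  subMFC_with P xbar s ->
  exists lam, W_multiplier P xbar lam /\
    forall Q, closed_cone Q -> (forall k, biactive P Q xbar (it_lam s k)) ->
      biactive P Q xbar lam.
Proof.
case=> I1 [I2 [I3 [[sI1 sI2 sI3] [ind [feas cvgs aw] pat act]]]].
have [U [c_ [t [mu [[FU sU c0 t0 nz] [ct cmu]]]]]] := cvg_homogenised (it_lam s).
have [cg_ ch_ cG_ cH_] := cvg_blocks cmu.
have cs : (it_x s k, it_del s k, it_eps s k) @[k --> U]
    --> (xbar, blocks0, (0 : 'rV[R]_n)).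
  by move=> A /cvgs; exact: sU.
have cx : it_x s @ U --> xbar by exact: cvg_proj1 (cvg_proj1 cs).
have ce : it_eps s @ U --> (0 : 'rV[R]_n) by exact: cvg_proj2 cs.
have sup k : supported_blocks I1 I2 I3 (it_lam s k).
  by have [-> -> ->] := act k; exact: approx_W_supported (aw k).
have entry0 d (v_ : nat -> 'rV[R]_d) (v : 'rV[R]_d) i :
    c_ k *: v_ k @[k --> U] --> v ->
    (forall k, v_ k 0 i = 0) -> v 0 i = 0.
  move=> cv v0; apply: (closed_cvg_entry (@closed_eq R 0) cv) => k /=.
  by rewrite mxE v0 mulr0.
have supmu : supported_blocks I1 I2 I3 mu.
  split=> i iI.
  - by apply: entry0 cg_ _ => k; have [h _ _] := sup k; exact: h.
  - by apply: entry0 cG_ _ => k; have [_ h _] := sup k; exact: h.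
  - by apply: entry0 cH_ _ => k; have [_ _ h] := sup k; exact: h.
have mug0 i : 0 <= bg mu 0 i.
  apply: (closed_cvg_entry (@closed_ge R 0) cg_) => k /=.
  have [_ /(_ i)[bg0 _ _] _ _] := aw k.
  by rewrite mxE mulr_ge0// ltW.
have sh : sign_dominated (bh (it_lam s 0)) (bh mu).
  by apply: (sign_dominated_cvg c0 _ ch_) => k; have [_ []] := pat 0 k.
have sG : sign_dominated (bG (it_lam s 0)) (bG mu).
  by apply: (sign_dominated_cvg c0 _ cG_) => k; have [_ []] := pat 0 k.
have sH : sign_dominated (bH (it_lam s 0)) (bH mu).
  by apply: (sign_dominated_cvg c0 _ cH_) => k; have [_ []] := pat 0 k.
have fj : fritz_john P xbar t mu = 0.
  apply/rowP => j.
  have c1 : fritz_john P (it_x s k) (c_ k) (c_ k *: it_lam s k) 0 j @[k --> U]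
      --> fritz_john P xbar t mu 0 j by exact: fritz_john_cvg.
  have c2 : c_ k * it_eps s k 0 j @[k --> U] --> t * 0.
    apply: cvgM => //; rewrite (_ : 0 = (0 : 'rV[R]_n) 0 j); last by rewrite mxE.
    exact: cvg_entry 0 j ce.
  rewrite mulr0 in c2.
  have fjk : (fun k => fritz_john P (it_x s k) (c_ k) (c_ k *: it_lam s k) 0 j) =
             (fun k => c_ k * it_eps s k 0 j).
    apply/funext => k; have [-> _ _ _] := aw k.
    by rewrite gradLccE// -{1}[c_ k]mulr1 fritz_johnZ mxE.
  rewrite fjk in c1; rewrite [RHS]mxE.
  exact: (cvg_unique (@Rhausdorff R) c1 c2).
have {}t0 : 0 < t.
  rewrite lt_def t0 andbT; apply/eqP => t00; apply: (nz t00).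
  rewrite t00 in fj.
  exact: (supported_independent ind supmu mug0 sh sG sH fj).
have ti0 : 0 < t^-1 by rewrite invr_gt0.
exists (t^-1 *: mu); split.
  have [s1 s2 s3] := supmu.
  split.
  - rewrite gradLccE// -(mulVf (lt0r_neq0 t0)) fritz_johnZ fj scaler0//.
  - move=> i; rewrite mxE mulr_ge0 ?(ltW ti0)//; split=> //.
    have [iI|/s1->] := boolP (i \in I1); last by rewrite mulr0 mul0r.
    by have := fintype.subsetP sI1 _ iI; rewrite inE mxE => /eqP->; rewrite mulr0.
  - move=> i ip; rewrite mxE s2 ?mulr0//.
    apply: contraL ip => /(fintype.subsetP sI2).
    rewrite !inE -andb_orr => /andP[/eqP-> _].
    by rewrite ltxx.
  - move=> i ip; rewrite mxE s3 ?mulr0//.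
    apply: contraL ip => /(fintype.subsetP sI3).
    rewrite !inE -andb_orl => /andP[_ /eqP->].
    by rewrite ltxx andbF.
move=> Q clQ Qk i ib; rewrite !mxE; apply: clQ.1 => //.
apply: (closed_cone_cvg clQ _ (cvg_entry 0 i cG_) (cvg_entry 0 i cH_)) => k.
by rewrite !mxE; apply: clQ.1 => //; exact: Qk.
Qed.

End MultiplierLimit.

Theorem theorem5p11 (R : realType) (n m p q : nat) (hq : (0 < q)%N)
    (P : mpcc R n m p q) (hP : smooth_mpcc P)
    (xbar : 'rV[R]_n) (hAW : AW_stationary P xbar)
    (s : iterates R n m p q) (hs : subMFC_with P xbar s) :
  [/\ W_stationary P xbar,
      approx_C P xbar s -> C_stationary P xbar,
      approx_M P xbar s -> M_stationary P xbar &
      strict_approx_S P xbar s -> S_stationary P xbar].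
Proof.
have [lam [Wlam Qlam]] := W_multiplier_limit hP hs.
have feas : feasible P xbar by case: hAW => ? [].
split; first by split=> //; exists lam.
- case=> _ Ck; split=> //; exists lam; split=> //.
  exact: Qlam (@closed_cone_C R) Ck.
- case=> _ Mk; split=> //; exists lam; split=> //.
  exact: Qlam (@closed_cone_M R) Mk.
- case=> _ Sk; split=> //; exists lam; split=> //.
  exact: Qlam (@closed_cone_S R) Sk.
Qed.
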